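(* Let $p$ be an odd prime, let $n,m$ be positive integers, let $G_1$ be a connected graph of order $n$ and let $G_2$ be a connected graph of order $mp$. Let $g_1:V(G_1)\to\{1,2,\ldots,n\}$ and $g_2:V(G_2)\to\{1,2,\ldots,mp\}$ be bijections, and for $i=1,2$ put $$\varrho_i=\{ab\in E(G_i):([g_i(a)+g_i(b)]/p)=1\},$$ $$\eta_i=\{ab\in E(G_i):([g_i(a)+g_i(b)]/p)=-1\text{ or }g_i(a)+g_i(b)\equiv 0\pmod p\}.$$ If $$|\varrho_1|+n|\varrho_2|=|\eta_1|+n|\eta_2|+nm\pm 1\quad\text{(either sign)}$$ or $$|\varrho_1|+n|\varrho_2|=|\eta_1|+n|\eta_2|+nm,$$ then the corona graph $G_1\circ G_2$ is a Legendre cordial graph modulo $p$.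
   Context: All graphs are finite, simple, and connected. The order of a graph is its number of vertices. Corona: if $G_1$ has order $n$, the corona graph $G_1\circ G_2$ is obtained by taking one copy of $G_1$ and $n$ disjoint copies of $G_2$, and joining the $i$th vertex of $G_1$ to every vertex of the $i$th copy of $G_2$, for $i=1,\ldots,n$. Legendre symbol: for an odd prime $p$ and an integer $a$ relatively prime to $p$, $(a/p)=1$ if $x^2\equiv a\pmod p$ has a solution and $(a/p)=-1$ otherwise. Legendre cordial labeling: let $p$ be an odd prime and $H$ a simple connected graph of order $N$. A bijection $f:V(H)\to\{1,2,\ldots,N\}$ is a Legendre cordial labeling modulo $p$ if the induced function $f_p^*:E(H)\to\{0,1\}$, defined by $f_p^*(uv)=0$ if $([f(u)+f(v)]/p)=-1$ or $f(u)+f(v)\equiv 0\pmod p$, and $f_p^*(uv)=1$ if $([f(u)+f(v)]/p)=1$, satisfies $|e_{f_p^*}(0)-e_{f_p^*}(1)|\leq 1$, where $e_{f_p^*}(i)$ is the number of edges with label $i$ ($i=0,1$). A graph admitting such a labeling is called a Legendre cordial graph modulo $p$. *)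

(* Defs.v *)
From mathcomp Require Import all_boot all_order all_algebra.

Set Implicit Arguments.
Unset Strict Implicit.
Unset Printing Implicit Defensive.

Import Order.TTheory GRing.Theory Num.Theory.

Local Open Scope ring_scope.

Record sgraph := SGraph {
  vertex :> finType;
  adj : rel vertex;
  adj_sym : symmetric adj;
  adj_irrefl : irreflexive adj
}.

Definition connected_graph (G : sgraph) : Prop :=
  (0 < #|G|)%N /\ forall x y : G, connect (@adj G) x y.

Definition edges (G : sgraph) : {set {set G}} :=
  [set [set xy.1; xy.2] | xy : G * G & adj xy.1 xy.2].

(* The vertices of the copies of [G2] are indexed by [G1] itself: [inr (i, x)]
   is the vertex [x] of the copy of [G2] attached to the vertex [i]. *)
Section Corona.
Variables G1 G2 : sgraph.

Definition corona_adj (a b : G1 + G1 * G2) : bool :=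
  match a, b with
  | inl i, inl j => adj i j
  | inl i, inr (j, _) => i == j
  | inr (i, _), inl j => i == j
  | inr (i, x), inr (j, y) => (i == j) && adj x y
  end.

Lemma corona_adj_sym : symmetric corona_adj.
Proof.
move=> [i|[i x]] [j|[j y]] //=; first exact: adj_sym.
by rewrite eq_sym adj_sym.
Qed.

Lemma corona_adj_irrefl : irreflexive corona_adj.
Proof. by move=> [i|[i x]] /=; rewrite adj_irrefl ?andbF. Qed.

Definition corona : sgraph := SGraph corona_adj_sym corona_adj_irrefl.

End Corona.

(* The value 0 on multiples of [p] is the usual convention. A solution of
   x^2 = a modulo [p] may be sought among the residues 0, ..., p - 1. *)
Definition legendre (p : nat) (a : int) : int :=
  if (p %| a)%Z then 0
  else if [exists x : 'I_p, ((x : nat)%:Z ^+ 2 == a %[mod p])%Z] then 1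
  else -1.

Definition bijection_onto_1 (T : Type) (N : nat) (f : T -> nat) : Prop :=
  [/\ injective f,
      forall v, (1 <= f v <= N)%N
    & forall k, (1 <= k <= N)%N -> exists v, f v = k].

Section Labeling.
Variables (p : nat) (G : sgraph) (f : G -> nat).

(* For an edge e = {u, v}, with u != v, this is f(u) + f(v). *)
Definition edge_sum (e : {set G}) : int := (\sum_(v in e) f v)%N%:Z.

Definition rho : {set {set G}} :=
  [set e in edges G | legendre p (edge_sum e) == 1].

Definition eta : {set {set G}} :=
  [set e in edges G | (legendre p (edge_sum e) == -1)
                      || (edge_sum e == 0 %[mod p])%Z].

Definition induced_label (e : {set G}) : nat :=
  if (legendre p (edge_sum e) == -1) || (edge_sum e == 0 %[mod p])%Z
  then 0%N else 1%N.

Definition num_edges_labeled (i : nat) : nat :=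
  #|[set e in edges G | induced_label e == i]|.

Definition legendre_cordial_labeling : Prop :=
  bijection_onto_1 #|G| f /\
  `|(num_edges_labeled 0)%:Z - (num_edges_labeled 1)%:Z| <= 1.

End Labeling.

Definition legendre_cordial_graph (p : nat) (H : sgraph) : Prop :=
  connected_graph H /\
  exists f : H -> nat, legendre_cordial_labeling p f.

(* Main.v *)
Require Import Defs.
From mathcomp Require Import all_boot all_order all_algebra.
From mathcomp Require Import zify.

(** Count each edge with a sign, 1 if its sum is a nonzero square modulo [p] and
    -1 otherwise. The signed count of a labeled graph is the number of edges
    labeled 1 minus the number labeled 0, that is [|rho| - |eta|], and a
    labeling is cordial when the signed count lies in [-1 .. 1]. It depends only on the
    labels modulo [p].

    Label the copies of [G2] by [g2] shifted by multiples of [m * p], and [G1]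
    by [g1] shifted by [n * (m * p)]. All shifts vanish modulo [p], so the edges of
    [G1] contribute [|rho_1| - |eta_1|] and those of the [n] copies of [G2]
    contribute [n * (|rho_2| - |eta_2|)]. The spokes joining a vertex of [G1] to
    its copy of [G2] have sums meeting every residue class exactly [m] times.
    Since an odd prime has [(p - 1) / 2] nonzero squares, the signs over one
    system of residues add up to -1 ([sum_residue_sign]), and all the spokes
    together contribute [- n * m]. The total ([sum_corona_edge_sign]) is

      [(|rho_1| - |eta_1|) + n * (|rho_2| - |eta_2|) - n * m],

    which the three cases of the hypothesis make equal to 1, -1 or 0. *)

Set Implicit Arguments.
Unset Strict Implicit.
Unset Printing Implicit Defensive.

Import Order.TTheory GRing.Theory Num.Theory.

Local Open Scope ring_scope.

(** * Squares modulo an odd prime *)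

Lemma eqFp_nat p : prime p -> forall a b : nat,
  (a%:R == b%:R :> 'F_p) = (a == b %[mod p])%N.
Proof. by move=> pp a b; rewrite -val_eqE /= !val_Fp_nat. Qed.

(** This is the Legendre symbol except that 0 is sent to -1: multiples of [p]
    and nonresidues both give the edge label 0, so the two cases count alike. *)
Definition residue_sign p (a : 'F_p) : int :=
  if (a != 0) && [exists x : 'F_p, x ^+ 2 == a] then 1 else -1.

Lemma int_eq_sqr_mod p (x N : nat) : prime p ->
  (x%:Z ^+ 2 == N%:Z %[mod p])%Z = (x%:R ^+ 2 == N%:R :> 'F_p).
Proof.
move=> pp; have -> : x%:Z ^+ 2 = (x ^ 2)%N%:Z by rewrite -!natz natrX.
by rewrite !modz_nat eqz_nat -(eqFp_nat pp) natrX.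
Qed.

Lemma legendre_natE p (N : nat) : prime p ->
  legendre p N%:Z = if N%:R == 0 :> 'F_p then 0 else residue_sign (N%:R : 'F_p).
Proof.
move=> pp; rewrite /legendre /residue_sign.
have -> : (p %| N%:Z)%Z = (N%:R == 0 :> 'F_p).
  by rewrite dvdzE !absz_nat (dvdn_pcharf (pchar_Fp pp)).
case: ifP => //= _; congr (if _ then _ else _).
apply/existsP/existsP => [[x hx]|[x hx]].
  by exists (x : nat)%:R; rewrite -int_eq_sqr_mod.
have xp : (x < p)%N by rewrite -{2}(Fp_cast pp) ltn_ord.
by exists (Ordinal xp); rewrite int_eq_sqr_mod //= natr_Zp.
Qed.

Lemma legendre_eq1 p (N : nat) : prime p ->
  (legendre p N%:Z == 1) = (residue_sign (N%:R : 'F_p) == 1).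
Proof.
by move=> pp; rewrite legendre_natE // /residue_sign; case: (_ == 0).
Qed.

(** A nonzero square has the two square roots [x] and [- x], distinct because
    [p] is odd. The last summand corrects for 0, whose sign is -1 although it
    has one square root. *)
Lemma card_sqrt_Fp p : prime p -> odd p -> forall a : 'F_p,
  (#|[set x : 'F_p | x ^+ 2 == a]|)%:Z = residue_sign a + 1 + (a == 0)%:Z.
Proof.
move=> pp op a; rewrite /residue_sign; case: (eqVneq a 0) => [->|a0] /=.
  rewrite (_ : [set _ | _] = [set 0]) ?cards1 //.
  by apply/setP=> x; rewrite !inE sqrf_eq0.
case: existsP => [[x /eqP xa]|nx]; last first.
  rewrite (_ : [set _ | _] = set0) ?cards0 //.
  by apply/setP=> x; rewrite !inE; apply/negP=> h; apply: nx; exists x.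
have x0 : x != 0 by apply: contraNneq a0 => x0; rewrite -xa x0 expr0n.
have n2 : 2%:R != 0 :> 'F_p.
  rewrite -(dvdn_pcharf (pchar_Fp pp)) gtnNdvd //.
  by rewrite odd_prime_gt2.
have xNx : x != - x.
  by rewrite -subr_eq0 opprK -mulr2n -mulr_natl mulf_neq0.
rewrite (_ : [set _ | _] = [set x; - x]) ?cards2 ?xNx //.
by apply/setP=> y; rewrite !inE -xa eqf_sqr.
Qed.

(** Sorting the [p] elements of the field by their squares gives
    [p = \sum_a (residue_sign a + 1) + 1]. *)
Lemma sum_residue_sign p : prime p -> odd p ->
  \sum_(a : 'F_p) residue_sign a = -1.
Proof.
move=> pp op.
have cF : #|{: 'F_p}| = p by rewrite card_Fp.
have : \sum_(a : 'F_p) (#|[set x : 'F_p | x ^+ 2 == a]|)%:Z = p%:Z.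
  rewrite -[in RHS]cF -[in RHS]sum1_card.
  rewrite [in RHS](partition_big (fun x : 'F_p => x ^+ 2) xpredT) //=.
  rewrite (big_morph Posz PoszD (erefl _)); apply: eq_bigr => a _.
  by rewrite -sum1dep_card.
under eq_bigr => a _ do rewrite card_sqrt_Fp //.
rewrite !big_split /= sumr_const cF.
have -> : \sum_(a : 'F_p) (a == 0)%:Z = 1.
  by rewrite (bigD1 (0 : 'F_p)) //= big1 // => a /negPf->.
by rewrite natz; move: (\sum_(a : _) residue_sign a) => S; lia.
Qed.

(** * Signed edge counts *)

Definition edge_sign p (G : sgraph) (f : G -> nat) (e : {set G}) : int :=
  residue_sign ((\sum_(v in e) f v)%N%:R : 'F_p).

Lemma residue_sign_neq1 p (a : 'F_p) :
  residue_sign a != 1 -> residue_sign a = -1.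
Proof. by rewrite /residue_sign; case: ifP. Qed.

Lemma edge_sign_neq1 p (G : sgraph) (f : G -> nat) (e : {set G}) : prime p ->
  (legendre p (edge_sum f e) == -1) || (edge_sum f e == 0 %[mod p])%Z
  = (edge_sign p f e != 1).
Proof.
move=> pp; rewrite /edge_sign /edge_sum legendre_natE //.
set N := (\sum_(_ in _) _)%N.
rewrite mod0z modz_nat eqz_nat -/(dvdn p N) (dvdn_pcharf (pchar_Fp pp)).
by rewrite /residue_sign; case: (_ == 0) => //=; case: ifP.
Qed.

Lemma sum_sign_card (T : finType) (E : {set T}) (w : T -> int) :
  (forall e, w e != 1 -> w e = -1) ->
  \sum_(e in E) w e =
    #|[set e in E | w e == 1]|%:Z - #|[set e in E | w e != 1]|%:Z.
Proof.
move=> w1; rewrite (bigID (fun e => w e == 1)) /=.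
rewrite -!sum1dep_card !(big_morph Posz PoszD (erefl _)) -sumrN.
by congr (_ + _); apply: eq_bigr => e /andP[_]; [move/eqP | move/w1].
Qed.

Lemma card_rho_eta p (G : sgraph) (f : G -> nat) : prime p ->
  #|rho p f|%:Z - #|eta p f|%:Z = \sum_(e in edges G) edge_sign p f e.
Proof.
move=> pp; rewrite sum_sign_card; last by move=> e /residue_sign_neq1.
congr (Posz _ - Posz _); apply: eq_card => e; rewrite !inE; congr (_ && _).
  by rewrite /edge_sum legendre_eq1.
exact: edge_sign_neq1.
Qed.

Lemma num_edges_labeled0 p (G : sgraph) (f : G -> nat) :
  num_edges_labeled p f 0 = #|eta p f|.
Proof.
by apply: eq_card => e; rewrite !inE /induced_label; case: (_ || _).
Qed.

Lemma num_edges_labeled1 p (G : sgraph) (f : G -> nat) : prime p ->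
  num_edges_labeled p f 1 = #|rho p f|.
Proof.
move=> pp; rewrite /num_edges_labeled; apply: eq_card => e.
rewrite !inE /induced_label edge_sign_neq1 // [in RHS]/edge_sum legendre_eq1 //.
by rewrite -/(edge_sign p f e); case: (_ == 1 :> int).
Qed.

(** * Edge sums as sums over ordered pairs of adjacent vertices *)

Lemma set2_eqE (T : finType) (x y u v : T) : x != y ->
  ([set u; v] == [set x; y])
  = ((u, v) == (x, y)) || ((u, v) == (y, x)).
Proof.
move=> xy; apply/eqP/orP => [uv|[]/eqP[-> ->]//]; last by rewrite setUC.
have hu : u \in [set x; y] by rewrite -uv set21.
have hv : v \in [set x; y] by rewrite -uv set22.
have hx : x \in [set u; v] by rewrite uv set21.
have hy : y \in [set u; v] by rewrite uv set22.
move: hu hv hx hy; rewrite !inE !xpair_eqE.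
by do 2![case/orP => /eqP->]; rewrite ?eqxx /= ?orbb ?[y == x]eq_sym
  ?(negPf xy) //=; auto.
Qed.

(** Each edge is the image of exactly two ordered adjacent pairs. Ordered pairs
    are preferable to edges here because the vertex type of a corona is a sum
    type, along which a double sum over vertices splits by itself. *)
Lemma sum_edges_darts (G : sgraph) (F : {set G} -> int) :
  \sum_(x : G) \sum_(y : G | adj x y) F [set x; y]
  = 2 * \sum_(e in edges G) F e.
Proof.
rewrite pair_big_dep /=.
rewrite (partition_big (fun xy : G * G => [set xy.1; xy.2]) (mem (edges G))) /=;
  last by move=> xy axy; apply/imsetP; exists xy; rewrite ?inE.
rewrite mulr_sumr; apply: eq_bigr => e /imsetP[[x y]]; rewrite inE /= => axy ->.
have xy : x != y by apply: contraTneq axy => ->; rewrite adj_irrefl.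
rewrite (eq_bigl (mem [set (x, y); (y, x)])) => [|[u v]]; last first.
  rewrite /= set2_eqE // !inE andb_idl // => /orP[]/eqP[-> ->] //.
  by rewrite adj_sym.
rewrite big_setU1 /= ?big_set1 ?inE; last by rewrite xpair_eqE (negPf xy).
by rewrite /= [[set y; x]]setUC -mulr2n mulr_natl.
Qed.

Lemma sum_edge_sign_darts p (G : sgraph) (f : G -> nat) :
  2 * \sum_(e in edges G) edge_sign p f e
  = \sum_(x : G) \sum_(y : G | adj x y)
      residue_sign ((f x)%:R + (f y)%:R : 'F_p).
Proof.
rewrite -sum_edges_darts; apply: eq_bigr => x _; apply: eq_bigr => y axy.
rewrite /edge_sign big_setU1 /= ?big_set1 ?natrD // inE.
by apply: contraTneq axy => ->; rewrite adj_irrefl.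
Qed.

(** The darts (ordered adjacent pairs) of the corona fall into three families:
    those of [G1], those of the copies of [G2], and the spokes. The symmetry of
    [F] makes the two orientations of a spoke contribute equally. *)
Lemma sum_corona_darts (G1 G2 : sgraph)
    (F : corona G1 G2 -> corona G1 G2 -> int) :
  (forall a b, F a b = F b a) ->
  \sum_(a : corona G1 G2) \sum_(b : corona G1 G2 | adj a b) F a b
  = \sum_(i : G1) \sum_(j : G1 | adj i j) F (inl i) (inl j)
    + 2 * \sum_(i : G1) \sum_(x : G2) F (inl i) (inr (i, x))
    + \sum_(i : G1) \sum_(x : G2) \sum_(y : G2 | adj x y)
        F (inr (i, x)) (inr (i, y)).
Proof.
move=> Fsym.
rewrite big_sumType /=.
under eq_bigr => i _ do rewrite big_sumType /=.
rewrite big_split /= -addrA -addrA; congr (_ + _).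
have spokes i : \sum_(jx : G1 * G2 | adj (inl i : corona G1 G2) (inr jx))
      F (inl i) (inr jx) = \sum_(x : G2) F (inl i) (inr (i, x)).
  rewrite (reindex_onto (fun x => (i, x)) snd) /= => [|[j x] /eqP<- //].
  by apply: eq_bigl => x; rewrite !eqxx.
under eq_bigr => i _ do rewrite spokes.
rewrite mulr_natl mulr2n -addrA; congr (_ + _).
rewrite -big_split /=; under [RHS]eq_bigr => i _ do rewrite -big_split /=.
rewrite [RHS]pair_bigA /=; apply: eq_bigr => -[i x] _ /=.
rewrite big_sumType /=; congr (_ + _).
  by rewrite (big_pred1 i) // => j; rewrite eq_sym.
rewrite (reindex_onto (fun y => (i, y)) snd) /= => [|[j y] /andP[/eqP<- _] //].
by apply: eq_bigl => y; rewrite !eqxx andbT.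
Qed.

(** * Sums over consecutive labels *)

Lemma sum_bijection_onto_1 (T : finType) N (g : T -> nat) (F : nat -> int) :
  bijection_onto_1 N g -> \sum_(x : T) F (g x) = \sum_(k < N) F k.+1.
Proof.
case=> ginj grange gsurj; rewrite -(big_mkord xpredT (fun k => F k.+1)).
rewrite -(big_add1 _ _ 0 N.+1 xpredT F) -(big_map g xpredT F).
apply: perm_big; apply: uniq_perm.
- by rewrite map_inj_uniq ?index_enum_uniq.
- exact: iota_uniq.
move=> k; rewrite mem_index_iota ltnS.
apply/mapP/idP => [[x _ ->]//|/gsurj[x <-]].
by exists x; rewrite ?mem_index_enum.
Qed.

(** The range [0 .. m * p - 1] consists of [m] complete systems of residues. *)
Lemma sum_residues p m (h : 'F_p -> int) : prime p ->
  \sum_(k < m * p) h k%:R = m%:Z * \sum_a h a.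
Proof.
move=> pp.
have block : \sum_(k < p) h k%:R = \sum_a h a.
  rewrite [RHS](reindex (fun k : 'I_p => k%:R)) //=; apply: onW_bij.
  apply: inj_card_bij => [j k /eqP|]; last by rewrite card_Fp ?card_ord.
  by rewrite eqFp_nat // !modn_small // => /eqP/val_inj.
elim: m => [|m IH]; first by rewrite big_ord0 mul0r.
rewrite mulSn addnC big_split_ord /= IH intS mulrDl mul1r addrC -block.
congr (_ + _); apply: eq_bigr => k _.
by rewrite natrD natrM pchar_Fp_0 // mulr0 add0r.
Qed.

(** * The labeling of the corona *)

(** Division with the remainder taken in [1 .. N] instead of [0 .. N - 1], which
    is the range of labels inside one copy of [G2]. *)
Lemma block_index_eq N a b x y :
  (1 <= x <= N)%N -> (1 <= y <= N)%N -> (a * N + x = b * N + y)%N -> a = b.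
Proof.
move=> xN yN; have [ab|ba|//] := ltngtP a b.
  have := leq_mul ab (leqnn N); rewrite mulSn; lia.
have := leq_mul ba (leqnn N); rewrite mulSn; lia.
Qed.

Lemma inj_bijection_onto_1 (T : finType) (f : T -> nat) :
  injective f -> (forall v, (1 <= f v <= #|T|)%N) -> bijection_onto_1 #|T| f.
Proof.
move=> finj frange; split=> // k /andP[k1 kN].
have fP v : ((f v).-1 < #|T|)%N by have := frange v; lia.
have tag_inj : injective (fun v => Ordinal (fP v)).
  by move=> u v [] uv; apply: finj; have := frange u; have := frange v; lia.
have [|h _ hK] := inj_card_bij tag_inj; first by rewrite card_ord.
have kP : (k.-1 < #|T|)%N by lia.
move: (h _) (hK (Ordinal kP)) => v [vk].
by exists v; have := frange v; lia.
Qed.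

Lemma connected_corona (G1 G2 : sgraph) :
  connected_graph G1 -> connected_graph (corona G1 G2).
Proof.
case=> /card_gt0P[i0 _] conn1; split.
  by apply/card_gt0P; exists (inl i0).
have csym : connect_sym (@adj (corona G1 G2)).
  by apply: sym_connect_sym; exact: adj_sym.
have inlC i j : connect (@adj (corona G1 G2)) (inl i) (inl j).
  have /connectP[s si ->] := conn1 i j.
  elim: s i si => //= k s IH i /andP[ik /IH]; apply: connect_trans.
  exact: connect1.
suff to_base a : connect (@adj (corona G1 G2)) (inl i0) a.
  by move=> a b; apply: connect_trans (to_base b); rewrite csym.
case: a => [i|[i x]]; first exact: inlC.
by apply: connect_trans (inlC i0 i) _; apply: connect1 => /=.
Qed.

(** The copies of [G2] take consecutive blocks of [k] labels, in the order given
    by [g1], and [G1] takes the last block. With [k] a multiple of [p], every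
    block starts at a multiple of [p], so that modulo [p] the corona carries
    exactly the labels [g1] and [g2]. *)
Definition corona_label n k (G1 G2 : sgraph) (g1 : G1 -> nat) (g2 : G2 -> nat)
    (v : corona G1 G2) : nat :=
  match v with
  | inl i => n * k + g1 i
  | inr (i, x) => (g1 i).-1 * k + g2 x
  end%N.

Lemma corona_label_bijection n k (G1 G2 : sgraph)
    (g1 : G1 -> nat) (g2 : G2 -> nat) :
  #|G1| = n -> #|G2| = k -> bijection_onto_1 n g1 -> bijection_onto_1 k g2 ->
  bijection_onto_1 #|corona G1 G2| (corona_label n k g1 g2).
Proof.
move=> cG1 cG2 [inj1 range1 _] [inj2 range2 _].
have copy_le i x : ((g1 i).-1 * k + g2 x <= n * k)%N.
  have [r1 r2] := (range1 i, range2 x).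
  have : ((g1 i).-1.+1 * k <= n * k)%N by apply: leq_mul => //; lia.
  by rewrite mulSn; lia.
apply: inj_bijection_onto_1 => [[i|[i x]] [j|[j y]] /=|v].
- by move/addnI/inj1->.
- by have := copy_le j y; have := range1 i; lia.
- by have := copy_le i x; have := range1 j; lia.
- move=> eqf; have [r1i r1j] := (range1 i, range1 j).
  have eij : (g1 i).-1 = (g1 j).-1 by exact: block_index_eq eqf.
  have ij : i = j by apply: inj1; lia.
  by move: eqf; rewrite ij => /addnI/inj2->.
rewrite card_sum card_prod cG1 cG2; case: v => [i|[i x]] /=.
  by have := range1 i; lia.
have /andP[g2x _] := range2 x.
by rewrite addn_gt0 g2x orbT (leq_trans (copy_le i x)) ?leq_addl.
Qed.

(** Modulo [p], the edges of [G1] and of the copies of [G2] keep their sums. The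
    spokes at a vertex [i] have sums [g1 i + g2 x], which run [m] times through
    a complete system of residues, so their signs add up to [- m]. *)
Lemma sum_corona_edge_sign p n m (G1 G2 : sgraph)
    (g1 : G1 -> nat) (g2 : G2 -> nat) :
  prime p -> odd p -> #|G1| = n -> bijection_onto_1 (m * p) g2 ->
  \sum_(e in edges (corona G1 G2)) edge_sign p (corona_label n (m * p) g1 g2) e
  = \sum_(e in edges G1) edge_sign p g1 e
    + n%:Z * \sum_(e in edges G2) edge_sign p g2 e - n%:Z * m%:Z.
Proof.
move=> pp op cG1 bij2.
have p0 : p%:R = 0 :> 'F_p by exact: pchar_Fp_0.
have labl i : (corona_label n (m * p) g1 g2 (inl i))%:R = (g1 i)%:R :> 'F_p.
  by rewrite /= natrD !natrM p0 !mulr0 add0r.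
have labr i x :
    (corona_label n (m * p) g1 g2 (inr (i, x)))%:R = (g2 x)%:R :> 'F_p.
  by rewrite /= natrD !natrM p0 !mulr0 add0r.
have spokes i :
    \sum_(x : G2) residue_sign ((g1 i)%:R + (g2 x)%:R : 'F_p) = - m%:Z.
  pose h (a : 'F_p) := residue_sign ((g1 i)%:R + a).
  rewrite (sum_bijection_onto_1 (fun k => h k%:R) bij2).
  under eq_bigr => k _ do rewrite -natr1.
  rewrite (sum_residues m (fun a => h (a + 1))) //.
  rewrite -(mulrN1 m%:Z) -(sum_residue_sign pp op); congr (_ * _).
  by rewrite [RHS](reindex_inj (inj_comp (addrI (g1 i)%:R) (addIr 1))).
have sum_const c : \sum_(i : G1) c = n%:Z * c.
  by rewrite sumr_const cG1 -mulr_natl natz.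
have sign_sym (a b : corona G1 G2) :
    residue_sign ((corona_label n (m * p) g1 g2 a)%:R
         + (corona_label n (m * p) g1 g2 b)%:R : 'F_p)
    = residue_sign ((corona_label n (m * p) g1 g2 b)%:R
         + (corona_label n (m * p) g1 g2 a)%:R : 'F_p) by rewrite addrC.
(* Doubling turns the three sums over edges into sums over darts. *)
apply: (mulfI (_ : 2 != 0 :> int)) => //.
rewrite mulrBr mulrDr [2 * (_ * \sum_(_ in _) _)]mulrCA !sum_edge_sign_darts.
rewrite (sum_corona_darts sign_sym) addrAC -mulrN -mulrN -!sum_const.
congr (_ + _ + 2 * _).
- by apply: eq_bigr => i _; apply: eq_bigr => j _; rewrite !labl.
- apply: eq_bigr => i _; apply: eq_bigr => x _; apply: eq_bigr => y _.
  by rewrite !labr.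
- apply: eq_bigr => i _; rewrite -[RHS](spokes i).
  by apply: eq_bigr => x _; rewrite labl labr.
Qed.

Theorem theorem3p4 (p n m : nat) (G1 G2 : sgraph)
    (g1 : G1 -> nat) (g2 : G2 -> nat)
    (hp : prime p) (hodd : odd p) (hn : (0 < n)%N) (hm : (0 < m)%N)
    (hG1 : connected_graph G1) (hG1n : #|G1| = n)
    (hG2 : connected_graph G2) (hG2n : #|G2| = (m * p)%N)
    (hg1 : bijection_onto_1 n g1) (hg2 : bijection_onto_1 (m * p) g2)
    (hcount :
       let r : int := #|rho p g1|%:Z + n%:Z * #|rho p g2|%:Z in
       let e : int := #|eta p g1|%:Z + n%:Z * #|eta p g2|%:Z in
       [\/ r = e + n%:Z * m%:Z + 1,
           r = e + n%:Z * m%:Z - 1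
         | r = e + n%:Z * m%:Z]) :
  legendre_cordial_graph p (corona G1 G2).
Proof.
split; first exact: connected_corona.
exists (corona_label n (m * p) g1 g2); split.
  exact: corona_label_bijection.
rewrite num_edges_labeled0 num_edges_labeled1 //.
have := card_rho_eta (corona_label n (m * p) g1 g2) hp.
rewrite (sum_corona_edge_sign _ hp hodd hG1n hg2).
rewrite -!card_rho_eta // mulrBr; case: hcount => h; lia.
Qed.
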